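(* Let $d\geq 2$. Then $\mathcal{P}(z,\lambda)$, regarded as a function of both $z$ and $\lambda$, is irreducible: there are no $f_1,f_2$, each a Laurent polynomial in $z$ with coefficients polynomial in $\lambda$, neither of the form $Cz^a$ with $C\neq 0$ a constant and $a\in\mathbb{Z}^d$, such that $\mathcal{P}=f_1f_2$.
   Context: Fix positive integers $q_1,\dots,q_d$ with greatest common divisor $1$, $Q=q_1\cdots q_d$, $\Gamma=q_1\mathbb{Z}\oplus\cdots\oplus q_d\mathbb{Z}$, and a $\Gamma$-periodic $V:\mathbb{Z}^d\to\mathbb{C}$. The discrete Laplacian is $(\Delta u)(n)=\sum_{\|n'-n\|_1=1}u(n')$. Let $W=\{n\in\mathbb{Z}^d:0\le n_j\le q_j-1\}$. For $z\in(\mathbb{C}\setminus\{0\})^d$, the space of $u:\mathbb{Z}^d\to\mathbb{C}$ with $u(n+q_je_j)=z_ju(n)$ for all $j,n$ is identified with $\mathbb{C}^W$ by restriction; $\mathcal{D}(z)$ is the $Q\times Q$ matrix of $-\Delta+V$ on this space and $\mathcal{P}(z,\lambda)=\det(\mathcal{D}(z)-\lambda I)$. Here $z^a=z_1^{a_1}\cdots z_d^{a_d}$. *)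

(* Defs.v *)
From HB Require Import structures.
From mathcomp Require Import all_boot all_order all_algebra.
From mathcomp Require Import reals.
From mathcomp Require Import complex.

Set Implicit Arguments.
Unset Strict Implicit.
Unset Printing Implicit Defensive.

Import Order.TTheory GRing.Theory Num.Theory.
Local Open Scope ring_scope.

Definition lat (d : nat) := 'I_d -> int.
Definition unitv {d : nat} (j : 'I_d) : lat d := fun i => (i == j)%:Z.
Definition ladd {d : nat} (n m : lat d) : lat d := fun i => n i + m i.
Definition lsub {d : nat} (n m : lat d) : lat d := fun i => n i - m i.
Definition lscale {d : nat} (q : 'I_d -> nat) (n : lat d) : lat d :=
  fun i => (q i)%:Z * n i.

Definition zpow {K : fieldType} {d : nat} (z : 'I_d -> K) (a : lat d) : K :=
  \prod_(j < d) z j ^ a j.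

Definition dlap {K : fieldType} {d : nat} (u : lat d -> K) (n : lat d) : K :=
  \sum_(j < d) (u (ladd n (unitv j)) + u (lsub n (unitv j))).

Definition schr {K : fieldType} {d : nat} (V : lat d -> K) (u : lat d -> K)
  (n : lat d) : K := - dlap u n + V n * u n.

Definition periodic {K : fieldType} {d : nat} (q : 'I_d -> nat) (V : lat d -> K) :=
  forall (n : lat d) (j : 'I_d), V (ladd n (lscale q (unitv j))) = V n.

Definition W {d : nat} (q : 'I_d -> nat) := {dffun forall j : 'I_d, 'I_(q j)}.
Definition W_to_lat {d : nat} {q : 'I_d -> nat} (w : W q) : lat d :=
  fun j => (nat_of_ord (w j))%:Z.

(* Extension of v in K^W to the unique u : Z^d -> K with u|_W = v and
   u(n + q_j e_j) = z_j u(n): for n = w + (q_j k_j)_j with w in W,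
   u(n) = z^k v(w).  (For q_j > 0 exactly one w in W matches n.)  This is
   the inverse of the restriction map identifying the Floquet space with K^W. *)
Definition qext {K : fieldType} {d : nat} (q : 'I_d -> nat) (z : 'I_d -> K)
  (v : W q -> K) (n : lat d) : K :=
  \sum_(w : W q)
     (if [forall j, ((q j)%:Z %| (n j - W_to_lat w j))%Z]
      then zpow z (fun j => ((n j - W_to_lat w j) %/ (q j)%:Z)%Z) * v w
      else 0).

(* D(z): the matrix of -Delta + V on the Floquet space, in the standard basis
   of K^W (W enumerated as 'I_#|W|): column w' is the image of delta_{w'}. *)
Definition Dmat {K : fieldType} {d : nat} (q : 'I_d -> nat) (V : lat d -> K)
  (z : 'I_d -> K) : 'M[K]_#|W q| :=
  \matrix_(i, k)
    schr V (@qext K d q z (fun x : W q => ((x == enum_val k)%:R : K))) (W_to_lat (enum_val i)).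

Definition Pol {K : fieldType} {d : nat} (q : 'I_d -> nat) (V : lat d -> K)
  (z : 'I_d -> K) (l : K) : K :=
  \det (Dmat q V z - l%:M).

Definition torus {K : fieldType} {d : nat} (z : 'I_d -> K) := forall j, z j != 0.

Definition laurent_poly_fun {K : fieldType} {d : nat}
  (f : ('I_d -> K) -> K -> K) : Prop :=
  exists s : seq ({ffun 'I_d -> int} * {poly K}),
    forall z, torus z -> forall l,
      f z l = \sum_(c <- s) (c.2).[l] * zpow z (fun j => c.1 j).

Definition monomial_fun {K : fieldType} {d : nat}
  (f : ('I_d -> K) -> K -> K) : Prop :=
  exists (c : K) (a : lat d), c != 0 /\
    forall z, torus z -> forall l, f z l = c * zpow z a.

(* Main.v *)
Require Import Defs.
From HB Require Import structures.
From mathcomp Require Import all_boot all_order all_algebra.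
From mathcomp Require Import perm cyclic separable cyclotomic.
From mathcomp Require Import reals.
From mathcomp Require Import complex.
From mathcomp Require Import mpoly.

Set Implicit Arguments.
Unset Strict Implicit.
Unset Printing Implicit Defensive.

Import Order.TTheory GRing.Theory Num.Theory.
Local Open Scope ring_scope.
Local Open Scope complex_scope.

(** Put [z_j = (s_j t)^(q_j)] and [l = t x] and let [t] tend to infinity.  A
    discrete Fourier transform conjugates [D(z)] to a diagonal matrix plus a
    constant one, so the top part of [P] is, up to sign,
    [t^Q \prod_n (x + freq_n(s))], where [freq_n(s) = \sum_j w_j^(n_j) s_j] and
    [w_j] is a primitive [q_j]-th root of unity.  If [P = f1 f2], the top parts
    of [f1] and [f2] multiply to this product.  They are invariant under
    [s_j -> w_j^(n_j) s_j], because they come from functions of [s_j^(q_j)],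
    and these substitutions permute the distinct linear factors transitively.
    So one of them, say the top part of [f1], contains all [Q] factors.  Then
    [f1] has degree [Q] in [l], hence [f2] does not depend on [l], and
    comparing leading coefficients in [l] shows that [f2] divides a monomial
    in the ring of Laurent polynomials. *)

(** * Polynomials on the torus *)

Lemma poly_neq0_nonroot (C : numFieldType) (p : {poly C}) :
  p != 0 -> exists2 y, y != 0 & p.[y] != 0.
Proof.
move=> p0.
have Xp0 : 'X * p != 0 by rewrite mulf_neq0 // polyX_eq0.
pose rs := [seq i%:R : C | i <- iota 0 (size ('X * p))].
case: (boolP (all (root ('X * p)) rs)) => [rs_root|/allPn[y _]].
  have Urs : uniq rs.
    by rewrite map_inj_uniq ?iota_uniq // => i j /eqP; rewrite eqr_nat => /eqP.
  by have := max_poly_roots Xp0 rs_root Urs; rewrite size_map size_iota ltnn.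
by rewrite rootE hornerM hornerX mulf_eq0 negb_or => /andP[]; exists y.
Qed.

(** * Kronecker's substitution *)

Section Kronecker.

Variables (C : numFieldType) (d : nat).
Implicit Types (p r : {mpoly C[d]}) (m : 'X_{1..d}).

Definition kexp (D : nat) m : nat := (\sum_(i < d) m i * D ^ i)%N.

Lemma digits_inj (n D : nat) (a b : 'I_n -> nat) :
  (forall i, a i < D)%N -> (forall i, b i < D)%N ->
  (\sum_(i < n) a i * D ^ i = \sum_(i < n) b i * D ^ i)%N -> a =1 b.
Proof.
elim: n a b => [|n IHn] a b aD bD; first by move=> _ [].
have D0 : (0 < D)%N by exact: leq_ltn_trans (leq0n _) (aD ord0).
have step (c : 'I_n.+1 -> nat) : (\sum_(i < n.+1) c i * D ^ i =
    c ord0 + (\sum_(i < n) c (lift ord0 i) * D ^ i) * D)%N.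
  rewrite big_ord_recl expn0 muln1 big_distrl /=; congr (_ + _)%N.
  by apply: eq_bigr => i _; rewrite expnSr mulnA.
rewrite !step => /eqP eq_ab.
have /eqP eq0 : a ord0 == b ord0.
  have /eqP := congr1 (modn^~ D) (eqP eq_ab).
  by rewrite ![(_ + _ * D)%N]addnC !modnMDl !modn_small // => /eqP->.
move: eq_ab; rewrite eq0 eqn_add2l eqn_pmul2r // => /eqP /IHn eqS i.
case: (unliftP ord0 i) => [j|] -> //.
by apply: eqS => k.
Qed.

(* Kronecker's substitution; injective on monomials with exponents below [D],
   it reduces questions about several variables to one variable. *)
Definition kron (D : nat) : {mpoly C[d]} -> {poly C} :=
  mmap polyC (fun i => 'X^(D ^ i)).

Lemma kronE D p : kron D p = \sum_(m <- msupp p) p@_m *: 'X^(kexp D m).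
Proof.
rewrite /kron /mmap; apply: eq_bigr => m _; rewrite mul_polyC /mmap1.
congr (_ *: _); under eq_bigr do rewrite -exprM.
by rewrite prodrXr; congr ('X^_); apply: eq_bigr => i _; rewrite mulnC.
Qed.

Lemma msupp_lt D p m i : (msize p <= D)%N -> m \in msupp p -> (m i < D)%N.
Proof.
move=> pD mp; apply: leq_trans pD; apply: leq_trans (msize_mdeg_lt mp).
by rewrite ltnS mdegE (bigD1 i) //= leq_addr.
Qed.

Lemma kexp_inj D p : (msize p <= D)%N -> {in msupp p &, injective (kexp D)}.
Proof.
move=> pD m m' mp m'p eq_mm'; apply/mnmP.
by apply: digits_inj eq_mm' => i; exact: msupp_lt pD _.
Qed.

Lemma coef_kron D p m : (msize p <= D)%N -> m \in msupp p ->
  (kron D p)`_(kexp D m) = p@_m.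
Proof.
move=> pD mp; rewrite kronE coef_sum (bigD1_seq m) ?msupp_uniq //=.
rewrite coefZ coefXn eqxx mulr1 big_seq_cond big1 ?addr0 // => m'.
case/andP=> m'p ne_m; rewrite coefZ coefXn.
case: eqP => [/(kexp_inj pD mp m'p) eqm|]; last by rewrite mulr0.
by rewrite eqm eqxx in ne_m.
Qed.

Lemma horner_kron D p y : (kron D p).[y] = p.@[fun i => y ^+ (D ^ i)].
Proof.
rewrite kronE mevalE horner_sum; apply: eq_bigr => m _.
rewrite hornerZ hornerXn; congr (_ * _); under eq_bigr do rewrite -exprM.
by rewrite prodrXr; congr (_ ^+ _); apply: eq_bigr => i _; rewrite mulnC.
Qed.

Lemma kron_neq0 D p : (msize p <= D)%N -> p != 0 -> kron D p != 0.
Proof.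
move=> pD p0; have mp := mlead_supp p0.
have := mp; rewrite mcoeff_msupp -(coef_kron pD mp).
by apply: contraNneq => ->; rewrite coef0.
Qed.

(** A nonzero nonroot [y] of the Kronecker image gives a torus point whose coordinates are powers of
    [y]. *)
Lemma mpoly_neq0_torus p : p != 0 -> exists2 v, torus v & p.@[v] != 0.
Proof.
move=> /(kron_neq0 (leqnn _)) /poly_neq0_nonroot[y y0].
rewrite horner_kron; exists (fun i : 'I_d => y ^+ (msize p ^ i)) => // j.
exact: expf_neq0.
Qed.

Lemma mpoly_eq0_torus p : (forall v, torus v -> p.@[v] = 0) -> p = 0.
Proof.
move=> p_eq0; apply/eqP; apply/negPn/negP => /mpoly_neq0_torus[v tv].
by rewrite p_eq0 ?eqxx.
Qed.

Lemma mpoly_eq_torus p r : (forall v, torus v -> p.@[v] = r.@[v]) -> p = r.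
Proof.
move=> eq_pr; apply/eqP; rewrite -subr_eq0; apply/eqP.
by apply: mpoly_eq0_torus => v tv; rewrite mevalB eq_pr // subrr.
Qed.

(** The Kronecker image of [p] divides a power of ['X], so it is associate to some ['X^k]. All
    monomials of [p] then have the same image, and injectivity leaves only one. *)
Lemma mpoly_dvd_monomial p r c m : c != 0 -> p * r = c *: 'X_[m] ->
  exists c' m', c' != 0 /\ p = c' *: 'X_[m'].
Proof.
move=> c0 prE.
have p0 : p != 0.
  apply: contraNneq c0 => p0; move/(congr1 (mcoeff m)): prE.
  by rewrite p0 mul0r mcoeff0 mcoeffZ mcoeffX eqxx mulr1 => <-.
pose D := msize p.
have [k kP] : exists k, kron D p %= 'X^k.
  have : kron D p %| ('X - 0%:P) ^+ (kexp D m).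
    rewrite subr0 -(dvdpZr _ _ c0); apply/dvdpP; exists (kron D r).
    rewrite mulrC -[kron D p * _](@rmorphM _ _ (mmap polyC _)) prE.
    rewrite /= mmapZ mmapX -mul_polyC; congr (_ * _).
    rewrite /mmap1; under [RHS]eq_bigr do rewrite -exprM.
    by rewrite prodrXr; congr ('X^_); apply: eq_bigr => i _; rewrite mulnC.
  by case/dvdp_exp_XsubCP=> k _; rewrite subr0; exists k.
have kP' m' : m' \in msupp p -> kexp D m' = k.
  move=> m'p; have /eqpP[[u v] /= /andP[u0 v0] uv] := kP.
  have := congr1 (fun s : {poly C} => s`_(kexp D m')) uv.
  rewrite !coefZ (coef_kron (leqnn _) m'p) coefXn.
  case: eqP => // _ /eqP; rewrite mulr0 mulf_eq0 (negPf u0) /=.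
  by rewrite mcoeff_eq0 m'p.
exists p@_(mlead p), (mlead p); split.
  by rewrite -mcoeff_msupp mlead_supp.
rewrite [LHS]mpolyE (bigD1_seq (mlead p)) ?msupp_uniq ?mlead_supp //=.
rewrite big_seq_cond big1 ?addr0 // => m' /andP[m'p /eqP[]].
apply: (kexp_inj (leqnn D)) => //; first exact: mlead_supp.
by rewrite !kP' // mlead_supp.
Qed.

End Kronecker.

(** * Floquet spaces and the Fourier transform *)

(** In characteristic 0 the polynomial ['X^n - 1] is separable, and n distinct n-th roots of unity
    include a primitive one. *)
Lemma prim_root_exists (C : numClosedFieldType) n :
  (0 < n)%N -> exists z : C, n.-primitive_root z.
Proof.
pose p : {poly C} := 'X^n - 1; have [r Dp] := closed_field_poly_normal p.
move=> n_gt0; rewrite (monicP _) ?monicXnsubC // scale1r in Dp.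
have rn1 : all n.-unity_root r by apply/allP=> z; rewrite -root_prod_XsubC -Dp.
have sz_r : (n < (size r).+1)%N.
  by rewrite -(size_prod_XsubC r id) -Dp size_XnsubC.
have [|z _] := hasP (has_prim_root n_gt0 rn1 _ sz_r); last by exists z.
by rewrite -separable_prod_XsubC -Dp separable_Xn_sub_1 // pnatr_eq0 -lt0n.
Qed.

Section Zpow.

Variables (K : fieldType) (d : nat).
Implicit Types (y z : 'I_d -> K) (a b : lat d).

Lemma zpowD y a b : torus y -> zpow y (ladd a b) = zpow y a * zpow y b.
Proof.
by move=> ty; rewrite /zpow -big_split; apply: eq_bigr => j _; rewrite expfzDr.
Qed.

Lemma zpow_neq0 y a : torus y -> zpow y a != 0.
Proof. by move=> ty; apply/prodf_neq0 => j _; exact: expfz_neq0. Qed.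

Lemma zpowM y z a : zpow (fun j => y j * z j) a = zpow y a * zpow z a.
Proof.
by rewrite /zpow -big_split; apply: eq_bigr => j _; rewrite expfzMl.
Qed.

Lemma zpow_unitv y j : zpow y (unitv j) = y j.
Proof.
rewrite /zpow (bigD1 j) //= /unitv eqxx expr1z big1 ?mulr1 // => i /negPf->.
by rewrite expr0z.
Qed.

Lemma eq_zpow y z a b : y =1 z -> a =1 b -> zpow y a = zpow z b.
Proof. by move=> eq_yz eq_ab; apply: eq_bigr => j _; rewrite eq_yz eq_ab. Qed.

Lemma dlap_zpow y a : torus y ->
  dlap (zpow y) a = (\sum_(j < d) (y j + (y j)^-1)) * zpow y a.
Proof.
move=> ty; rewrite /dlap big_distrl; apply: eq_bigr => j _ /=.
rewrite zpowD // zpow_unitv mulrDl mulrC; congr (_ + _).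
apply: (mulIf (ty j)); rewrite -[y j in LHS]zpow_unitv -zpowD //.
rewrite mulrAC mulVf // mul1r.
by apply: eq_zpow => // i; rewrite /ladd /lsub subrK.
Qed.

End Zpow.

Section Floquet.

Variables (K : fieldType) (d : nat) (q : 'I_d -> nat).
Hypothesis q_gt0 : forall j, (0 < q j)%N.
Implicit Types (y z : 'I_d -> K) (n : lat d).

Lemma residueP n j : (`|(n j %% (q j)%:Z)%Z| < q j)%N.
Proof.
have q0 : (q j)%:Z != 0 by rewrite eqz_nat -lt0n.
by rewrite -ltz_nat gez0_abs ?modz_ge0 // ltz_pmod // ltz_nat.
Qed.

Definition residue n : W q := [ffun j => Ordinal (residueP n j)].

(** Division with remainder in each coordinate: a single term of the sum in [qext] survives. *)
Lemma residueE n w :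
  [forall j, ((q j)%:Z %| (n j - W_to_lat w j))%Z] = (w == residue n).
Proof.
have q0 j : (q j)%:Z != 0 by rewrite eqz_nat -lt0n.
apply/forallP/eqP => [dvd_w|-> j].
  apply/ffunP => j; apply: val_inj; rewrite ffunE /=; apply/eqP.
  have := dvd_w j; rewrite -eqz_nat gez0_abs ?modz_ge0 //.
  rewrite -eqz_mod_dvd => /eqP ->.
  by rewrite modz_small // ltz_nat ltn_ord.
rewrite -eqz_mod_dvd /W_to_lat ffunE /= gez0_abs ?modz_ge0 //.
by rewrite modz_mod.
Qed.

(** The plane wave with multipliers [y] satisfies the Floquet condition for [z], so it is the
    extension of its own restriction to [W]. *)
Lemma qext_zpow y z n : torus y -> (forall j, z j = y j ^+ q j) ->
  @qext K d q z (fun w => zpow y (W_to_lat w)) n = zpow y n.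
Proof.
move=> ty zE; rewrite /qext (bigD1 (residue n)) //= residueE eqxx.
rewrite [X in _ + X]big1 ?addr0 => [|w /negPf w_n]; last by rewrite residueE w_n.
have /forallP dvd_n : [forall j, ((q j)%:Z %| (n j - W_to_lat (residue n) j))%Z].
  by rewrite residueE.
rewrite /zpow -big_split; apply: eq_bigr => j _ /=.
rewrite zE exprnP exprz_exp -expfzDr //; congr (_ ^ _).
by rewrite mulrC divzK // subrK.
Qed.

Lemma qext_linear z (v : W q -> K) n :
  @qext K d q z v n =
  \sum_(k < #|W q|) qext z (fun x : W q => (x == enum_val k)%:R) n *
                    v (enum_val k).
Proof.
transitivity (\sum_(w' : W q) qext z (fun x : W q => (x == w')%:R) n * v w').
  rewrite /qext; under [RHS]eq_bigr do rewrite big_distrl /=.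
  rewrite exchange_big /=; apply: eq_bigr => w _.
  rewrite (bigD1 w) //= eqxx mulr1 big1 ?addr0 => [|w' /negPf w'w].
    by case: ifP; rewrite ?mul0r.
  by rewrite eq_sym w'w mulr0; case: ifP; rewrite mul0r.
by rewrite (reindex _ (onW_bij _ (enum_val_bij (W q)))).
Qed.

Lemma Dmat_zpow V y z i : torus y -> (forall j, z j = y j ^+ q j) ->
  \sum_k Dmat q V z i k * zpow y (W_to_lat (enum_val k)) =
  (V (W_to_lat (enum_val i)) - \sum_(j < d) (y j + (y j)^-1)) *
    zpow y (W_to_lat (enum_val i)).
Proof.
move=> ty zE; set n := W_to_lat _.
rewrite mulrBl -dlap_zpow // addrC /schr.
have qextE n' : zpow y n' = \sum_(k < #|W q|)
    qext z (fun x : W q => (x == enum_val k)%:R) n' *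
    zpow y (W_to_lat (enum_val k)).
  by rewrite -[LHS](@qext_zpow y z) // qext_linear.
under eq_bigr => k _ do rewrite mxE /schr mulrDl mulNr -/n.
rewrite big_split /= sumrN; congr (- _ + _); last first.
  by rewrite qextE big_distrr; apply: eq_bigr => k _; rewrite /= mulrA.
under eq_bigr => k _ do rewrite big_distrl /=.
rewrite exchange_big /dlap; apply: eq_bigr => j _ /=.
rewrite [zpow y (ladd _ _)]qextE [zpow y (lsub _ _)]qextE -big_split.
by apply: eq_bigr => k _; rewrite mulrDl.
Qed.

End Floquet.

(** * Diagonalization of the Laplacian by the discrete Fourier transform *)

Section Fourier.

Variables (C : numClosedFieldType) (d : nat) (q : 'I_d -> nat).
Hypothesis q_gt0 : forall j, (0 < q j)%N.
Variable w : 'I_d -> C.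
Hypothesis w_prim : forall j, (q j).-primitive_root (w j).

Lemma w_neq0 : torus w.
Proof.
move=> j; apply: contra_eqN (prim_expr_order (w_prim j)) => /eqP->.
by rewrite expr0n eqn0Ngt q_gt0 eq_sym oner_eq0.
Qed.

(* Shifting [n] by one in direction [j0] multiplies the sum by [rho j0]. *)
Lemma sum_characters_eq0 (rho : 'I_d -> C) j0 :
  (forall j, rho j ^+ q j = 1) -> rho j0 != 1 ->
  \sum_(n : W q) \prod_(j < d) rho j ^+ n j = 0.
Proof.
move=> rho_q rho1; set S := LHS.
pose shift (s : forall j, 'I_(q j) -> 'I_(q j)) (n : W q) : W q :=
  [ffun j => if j == j0 then s j (n j) else n j].
have shift_bij : bijective (shift (fun j => @ordS (q j))).
  exists (shift (fun j => @ord_pred (q j))) => n; apply/ffunP => j;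
  by rewrite !ffunE; case: eqP; rewrite ?ordSK ?ord_predK.
suff : S * rho j0 = S.
  move/eqP; rewrite -{2}[S]mulr1 -subr_eq0 -mulrBr mulf_eq0 subr_eq0 (negPf rho1).
  by rewrite orbF => /eqP.
rewrite {2}/S (reindex _ (onW_bij _ shift_bij)) big_distrl; apply: eq_bigr => n _ /=.
rewrite (bigD1 j0) //= [RHS](bigD1 j0) //= ffunE eqxx /= expr_mod // exprSr.
rewrite mulrAC; congr (_ * _); apply: eq_bigr => j /negPf j_j0.
by rewrite ffunE j_j0.
Qed.

Definition dft : 'M[C]_#|W q| :=
  \matrix_(i, k) \prod_(j < d) (w j ^+ (enum_val k : W q) j) ^+ (enum_val i : W q) j.

(** Orthogonality of characters: the transposed entrywise inverse [G] inverts [dft] up to the factor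
    Q, nonzero in characteristic 0. *)
Lemma dft_unit : dft \in unitmx.
Proof.
pose G : 'M[C]_#|W q| := \matrix_(k, i)
  \prod_(j < d) ((w j ^+ (enum_val k : W q) j) ^+ (enum_val i : W q) j)^-1.
suff GE : dft *m G = (#|W q|%:R)%:M.
  have N0 : #|W q|%:R != 0 :> C.
    rewrite pnatr_eq0 -lt0n; apply/card_gt0P.
    by exists [ffun j => Ordinal (q_gt0 j)].
  have : \det (dft *m G) != 0.
    by rewrite GE det_scalar expf_neq0.
  by rewrite det_mulmx mulf_eq0 negb_or unitmxE unitfE => /andP[].
apply/matrixP => i i'; rewrite !mxE.
(* Entry (i, i') of the product sums the character given by [rho], trivial only for i = i'. *)
pose rho (j : 'I_d) : C :=
  w j ^+ (enum_val i : W q) j / w j ^+ (enum_val i' : W q) j.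
transitivity (\sum_(n : W q) \prod_(j < d) rho j ^+ n j).
  rewrite (reindex _ (onW_bij _ (enum_val_bij (W q)))) /=.
  apply: eq_bigr => k _; rewrite !mxE -big_split; apply: eq_bigr => j _ /=.
  by rewrite /rho exprMn exprVn -!exprM ![(enum_val k j * _)%N]mulnC.
have [eq_ii'|ne_ii'] := eqVneq i i'.
  rewrite mulr1n -sum1_card natr_sum; apply: eq_bigr => n _.
  by rewrite big1 // => j _; rewrite /rho eq_ii' divff ?expr1n // expf_neq0 // w_neq0.
have [j ne_j] : exists j, (enum_val i : W q) j != (enum_val i' : W q) j.
  apply/existsP; rewrite -negb_forall; apply: contraNN ne_ii' => /forallP eq_ii'.
  by apply/eqP/enum_val_inj/ffunP => j; exact/eqP/eq_ii'.
rewrite mulr0n (@sum_characters_eq0 rho j) // => [j'|].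
  rewrite /rho exprMn exprVn -!exprM ![(_ * q j')%N]mulnC !exprM.
  by rewrite (prim_expr_order (w_prim j')) !expr1n divr1.
rewrite /rho; apply: contraNneq ne_j => eq1; apply/eqP/val_inj => /=.
have /eqP : w j ^+ (enum_val i : W q) j = w j ^+ (enum_val i' : W q) j.
  by rewrite -[RHS]mul1r -eq1 divfK // expf_neq0 // w_neq0.
by rewrite (eq_prim_root_expr (w_prim j)) !modn_small // => /eqP.
Qed.

(** The plane waves [y k] share the q-th powers tau^q, so they form a basis of one Floquet space, in
    which the Laplacian is diagonal. The potential becomes a matrix [E] independent of [tau], hence
    negligible when [tau] is scaled up. *)
Lemma Pol_fourier (V : lat d -> C) : exists E : 'M[C]_#|W q|,
  forall tau l, torus tau -> Pol q V (fun j => tau j ^+ q j) l =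
    \det (E - diag_mx (\row_k (\sum_(j < d)
      (w j ^+ (enum_val k : W q) j * tau j
       + (w j ^+ (enum_val k : W q) j * tau j)^-1) + l))).
Proof.
pose DV : 'rV[C]_#|W q| := \row_k V (W_to_lat (enum_val k)).
exists (invmx dft *m diag_mx DV *m dft) => tau l t_tau.
set L := (\row_k _).
pose y (k : 'I_#|W q|) := fun j => w j ^+ (enum_val k : W q) j * tau j.
have ty k : torus (y k).
  by move=> j; rewrite mulf_neq0 ?expf_neq0 // w_neq0.
have yq k j : y k j ^+ q j = tau j ^+ q j.
  rewrite /y exprMn -exprM mulnC exprM (prim_expr_order (w_prim j)).
  by rewrite expr1n mul1r.
pose T : 'M[C]_#|W q| := diag_mx (\row_i zpow tau (W_to_lat (enum_val i))).
have detT : \det T != 0.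
  by rewrite det_diag; apply/prodf_neq0 => i _; rewrite mxE zpow_neq0.
have detF : \det dft != 0 by rewrite -unitfE -unitmxE dft_unit.
pose U := T *m dft.
have UE i k : U i k = zpow (y k) (W_to_lat (enum_val i)).
  rewrite /U mul_diag_mx !mxE zpowM mulrC; congr (_ * _).
have key : (Dmat q V (fun j => tau j ^+ q j) - l%:M) *m U =
    T *m (dft *m (invmx dft *m diag_mx DV *m dft - diag_mx L)).
  have DU : Dmat q V (fun j => tau j ^+ q j) *m U =
      diag_mx DV *m U - U *m diag_mx (L - const_mx l).
    rewrite mul_diag_mx mul_mx_diag; apply/matrixP => i k.
    rewrite mxE; under eq_bigr => k' _ do rewrite UE.
    rewrite (@Dmat_zpow _ _ _ q_gt0 _ (y k)) //.
    rewrite -UE; move: (U) => U'; rewrite !mxE mulrBl; congr (_ - _).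
    by rewrite [RHS]mulrC; congr (_ * _); rewrite -[RHS]addrA subrr addr0.
  rewrite mulmxBl DU raddfB /= diag_const_mx mulmxBr mul_mx_scalar.
  rewrite mul_scalar_mx opprB addrA addrAC addrK.
  rewrite mulmxBr !mulmxA mulmxV ?dft_unit // mul1mx mulmxBr !mulmxA.
  (* [T] commutes with the diagonal potential; this removes [tau] from [E]. *)
  by rewrite [T *m _]diag_mxC -/T.
apply: (mulIf detT); apply: (mulIf detF).
have := congr1 (@determinant _ _) key; rewrite !det_mulmx => det_key.
by rewrite -[LHS]mulrA [LHS]det_key -[RHS]mulrA [RHS]mulrC -[RHS]mulrA.
Qed.

End Fourier.

(** * Leading coefficients and Laurent polynomials *)

Lemma poly_eq_nonzero (C : numFieldType) (p r : {poly C}) :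
  (forall y, y != 0 -> p.[y] = r.[y]) -> p = r.
Proof.
move=> eq_pr; apply/eqP; rewrite -subr_eq0; apply/negPn/negP.
move=> /poly_neq0_nonroot[y y0]; rewrite hornerD hornerN eq_pr //.
by rewrite subrr eqxx.
Qed.

(** In the convolution, every index other than [m] passes one of the two bounds. The bounds need not
    be attained, so the top coefficients may vanish. *)
Lemma coefM_top (A : nzRingType) (p r : {poly A}) m n :
  (size p <= m.+1)%N -> (size r <= n.+1)%N -> (p * r)`_(m + n) = p`_m * r`_n.
Proof.
move=> szp szr; rewrite coefM.
have m_lt : (m < (m + n).+1)%N by rewrite ltnS leq_addr.
rewrite (bigD1 (Ordinal m_lt)) //= addKn big1 ?addr0 // => j.
rewrite -val_eqE /= neq_ltn => /orP[lt_jm|lt_mj].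
  rewrite [r`_ _]nth_default ?mulr0 //; apply: leq_trans szr _.
  by rewrite ltn_subRL ltn_add2r.
by rewrite nth_default ?mul0r //; exact: leq_trans szp lt_mj.
Qed.

Lemma prod_poly_top (A : nzRingType) (I : Type) (rs : seq I)
    (F : I -> {poly A}) k :
  (forall i, size (F i) <= k.+1)%N ->
  (size (\prod_(i <- rs) F i)%R <= (size rs * k).+1)%N /\
  (\prod_(i <- rs) F i)`_(size rs * k) = \prod_(i <- rs) (F i)`_k.
Proof.
move=> szF; elim: rs => [|i rs [IHs IHc]] /=.
  by rewrite !big_nil mul0n size_poly1 coef1.
rewrite !big_cons mulSn; split; last by rewrite coefM_top // IHc.
apply: leq_trans (size_polyMleq _ _) _.
by rewrite -subn1 leq_subLR add1n -addnS -addSn leq_add.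
Qed.

(** Each term of the Leibniz expansion is a product of n entries, so the top coefficient is taken
    entrywise. *)
Lemma det_poly_top (A : comNzRingType) n k (M : 'M[{poly A}]_n) :
  (forall i j, size (M i j) <= k.+1)%N ->
  (size (\det M) <= (n * k).+1)%N /\
  (\det M)`_(n * k) = \det (map_mx (fun p : {poly A} => p`_k) M).
Proof.
move=> szM.
have top (s : 'S_n) := @prod_poly_top A _ (index_enum 'I_n) (fun i => M i (s i))
  k (fun i => szM i (s i)).
have szI : size (index_enum 'I_n) = n by rewrite /index_enum -enumT size_enum_ord.
rewrite szI in top; split; rewrite /determinant.
  apply: leq_trans (size_sum _ _ _) _; apply/bigmax_leqP => s _.
  by rewrite -polyC1 -polyCN -polyC_exp mul_polyC (leq_trans (size_scale_leq _ _)) // (top s).1.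
rewrite coef_sum; apply: eq_bigr => s _.
rewrite -polyC1 -polyCN -polyC_exp coefCM (top s).2; congr (_ * _).
by apply: eq_bigr => i _; rewrite mxE.
Qed.

Section TorusEval.
Variables (C : numFieldType) (d : nat).

Lemma polympoly_eq (p r : {poly {mpoly C[d]}}) :
  (forall s, torus s -> forall x,
    (map_poly (meval s) p).[x] = (map_poly (meval s) r).[x]) -> p = r.
Proof.
move=> eq_pr; apply/polyP => i; apply: mpoly_eq_torus => s ts.
rewrite -!coef_map /=; suff -> : map_poly (meval s) p = map_poly (meval s) r by [].
by apply: poly_eq_nonzero => x _; exact: eq_pr.
Qed.

(** A large power of the product of the z_j clears the negative exponents; the sum of the absolute
    values of all exponents is large enough. *)
Lemma laurent_clear (f : ('I_d -> C) -> C -> C) : laurent_poly_fun f ->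
  exists (N : nat) (F : {poly {mpoly C[d]}}), forall z, torus z -> forall l,
    (map_poly (meval z) F).[l] = (\prod_j z j) ^+ N * f z l.
Proof.
case=> s fE; pose N := (\sum_(c <- s) \sum_j `|c.1 j|)%N.
have N_ge c j : c \in s -> 0 <= c.1 j + N%:Z.
  move=> cs; have le_N : (`|c.1 j| <= N)%N.
    rewrite /N (big_rem c) //= (bigD1 j) //= -addnA; exact: leq_addr.
  by rewrite -lerBlDl sub0r; apply: le_trans (_ : _ <= `|c.1 j|%N%:Z) _;
    [rewrite abszE -normrN ler_norm | rewrite lez_nat].
exists N, (\sum_(c <- s) map_poly (@mpolyC d C) c.2 *
             ('X_[ [multinom `|(c.1 j + N%:Z)%R|%N | j < d] ])%:P).
move=> z tz l; rewrite fE // rmorph_sum horner_sum big_distrr /=.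
rewrite big_seq [RHS]big_seq; apply: eq_bigr => c cs.
rewrite rmorphM hornerM /= map_polyC hornerC /= mevalX mulrCA; congr (_ * _).
  rewrite -map_poly_comp map_poly_id // => a _ /=.
  by rewrite mevalC.
rewrite -prodrXl -big_split; apply: eq_bigr => j _ /=.
by rewrite mnmE !exprnP gez0_abs ?N_ge // addrC expfzDr.
Qed.

End TorusEval.

Section CharPoly.
Variables (C : fieldType) (n : nat).

Lemma horner_char_poly (M : 'M[C]_n) l :
  \det (M - l%:M) = ((-1) ^+ n *: char_poly M).[l].
Proof.
rewrite hornerZ -[(char_poly M).[l]]/(horner_eval l (char_poly M)).
rewrite /char_poly -det_map_mx -detZ scaleN1r; congr (\det _).
apply/matrixP => i j; rewrite !mxE.
by rewrite /= /horner_eval hornerD hornerN hornerC hornerMn hornerX opprB.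
Qed.

End CharPoly.

(** * The scaling z -> (s t)^q, l -> t x *)

Section Scaling.

Variables (C : fieldType) (d : nat) (q : 'I_d -> nat).
Local Notation S := {mpoly C[d]}.
Implicit Types (p : S) (F : {poly S}).

Definition scale_z : S -> {poly S} :=
  mmap (polyC \o @mpolyC d C) (fun j => ('X_j *: 'X) ^+ q j).

(* In [{poly {poly S}}] the outer variable is [t] and the inner one is [x]; the
   variables of [S] itself are the [s_j]. *)
Definition scale_zl F : {poly {poly S}} :=
  (map_poly (map_poly polyC \o scale_z) F).['X * 'X%:P].

Definition eval_sx (s : 'I_d -> C) (x : C) : {poly {poly S}} -> {poly C} :=
  map_poly (horner_eval x \o map_poly (meval s)).

Lemma eval_sxM s x : {morph eval_sx s x : p r / p * r}.
Proof. exact: rmorphM. Qed.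

Lemma horner_eval_scale_zl s x t F :
  (eval_sx s x (scale_zl F)).[t] =
  (map_poly (meval (fun j => (s j * t) ^+ q j)) F).[t * x].
Proof.
(* Joint evaluation at s, x and t, packaged as a ring morphism so that it passes through
   [horner]. *)
pose psi : {rmorphism {poly {poly S}} -> C} := GRing.RMorphism.clone _ _
  (horner_eval t \o map_poly (horner_eval x \o map_poly (meval s))) _.
rewrite -[LHS]/(psi _) /scale_zl -horner_map -map_poly_comp.
have -> : psi ('X * 'X%:P) = t * x.
  rewrite rmorphM /= /psi /= map_polyX map_polyC /= map_polyX.
  by rewrite /horner_eval !hornerX hornerC.
congr (_.[_]); apply: eq_map_poly => p.
rewrite /= /psi /= -map_poly_comp.
have -> : map_poly ((horner_eval x \o map_poly (meval s)) \o polyC) (scale_z p)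
    = map_poly (meval s) (scale_z p).
  apply: eq_map_poly => a /=.
  by rewrite map_polyC /horner_eval hornerC.
rewrite /scale_z [RHS]mevalE /mmap rmorph_sum /horner_eval horner_sum.
apply: eq_bigr => m _; rewrite rmorphM hornerM /= map_polyC hornerC /= mevalC.
congr (_ * _); rewrite /mmap1 rmorph_prod horner_prod; apply: eq_bigr => j _.
rewrite !rmorphXn /= !horner_exp map_polyZ map_polyX hornerZ hornerX /=.
by rewrite mevalXU.
Qed.

(** The variable x enters only through l = t x, so its degree is at most that of [F] in l. *)
Lemma size_coef_scale_zl F i : (size ((scale_zl F)`_i)%R <= size F)%N.
Proof.
rewrite /scale_zl horner_poly coef_sum; apply: leq_trans (size_sum _ _ _) _.
apply/bigmax_leqP => k _; rewrite exprMn.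
rewrite -polyC_exp mulrA coefMC coefMXn /=; case: ltnP => _.
  by rewrite mul0r size_poly0.
rewrite coef_map /= mul_polyC; apply: leq_trans (size_scale_leq _ _) _.
by rewrite size_polyXn ltn_ord.
Qed.

Definition rotate_z (a : 'I_d -> C) : S -> S :=
  mmap (@mpolyC d C) (fun j => a j *: 'X_j).

(** After scaling, s_j occurs only through its [q j]-th power, which the rotation preserves. *)
Lemma rotate_scale_z a p : (forall j, a j ^+ q j = 1) ->
  map_poly (rotate_z a) (scale_z p) = scale_z p.
Proof.
move=> aq; rewrite /scale_z /mmap rmorph_sum; apply: eq_bigr => m _.
rewrite rmorphM /= map_polyC /= mmapC; congr (_ * _).
rewrite /mmap1 rmorph_prod; apply: eq_bigr => j _.
rewrite !rmorphXn /= map_polyZ map_polyX /= mmapX mmap1U.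
by congr (_ ^+ _); rewrite !exprZn aq scale1r.
Qed.

Lemma rotate_scale_zl a F : (forall j, a j ^+ q j = 1) ->
  map_poly (map_poly (rotate_z a)) (scale_zl F) = scale_zl F.
Proof.
move=> aq; rewrite /scale_zl -horner_map -map_poly_comp rmorphM /=.
rewrite map_polyX map_polyC /= map_polyX; congr (_.[_]).
apply: eq_map_poly => p /=; rewrite -map_poly_comp -[in RHS](rotate_scale_z p aq).
rewrite -map_poly_comp; apply: eq_map_poly => b /=.
by rewrite map_polyC.
Qed.

End Scaling.

(** * Factors of the characteristic polynomial *)

(** One factor vanishes at [- c i0], hence at all the distinct points [- c i]. The two propagation
    hypotheses will come from rotation invariance. *)
Lemma size_gt_of_roots (A : idomainType) (I : finType) (c : I -> A) (a : A)
    (F G : {poly A}) (i0 : I) :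
  injective c -> a != 0 -> F * G = a%:P * \prod_i ('X + (c i)%:P) ->
  (F.[- c i0] = 0 -> forall i, F.[- c i] = 0) ->
  (G.[- c i0] = 0 -> forall i, G.[- c i] = 0) ->
  (#|I| < size F)%N \/ (#|I| < size G)%N.
Proof.
move=> c_inj a0 FG rootF rootG.
have FG0 : F * G != 0.
  rewrite FG mulf_neq0 ?polyC_eq0 //; apply/prodf_neq0 => i _.
  by rewrite -[c i]opprK polyCN polyXsubC_eq0.
have many_roots (H : {poly A}) :
    H != 0 -> (forall i, H.[- c i] = 0) -> (#|I| < size H)%N.
  move=> H0 rootH; pose rs := [seq - c i | i <- enum I].
  have rsH : all (root H) rs by apply/allP => _ /mapP[i _ ->]; exact/eqP.
  have := max_poly_roots H0 rsH; rewrite size_map -cardE; apply.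
  by rewrite map_inj_uniq ?enum_uniq // => i j /oppr_inj /c_inj.
move: FG0; rewrite mulf_eq0 negb_or => /andP[F0 G0].
have : F.[- c i0] * G.[- c i0] = 0.
  rewrite -hornerM FG hornerM horner_prod (bigD1 i0) //=.
  by rewrite hornerD hornerX !hornerC addNr mul0r mulr0.
move/eqP; rewrite mulf_eq0 => /orP[] /eqP root0; [left | right];
apply: many_roots; auto.
Qed.

(** * Top parts of the factors and their degrees *)

Section Bloch.

Variables (C : numClosedFieldType) (d : nat) (q : 'I_d -> nat).
Hypothesis q_gt0 : forall j, (0 < q j)%N.
Variable V : lat d -> C.
Variable w : 'I_d -> C.
Hypothesis w_prim : forall j, (q j).-primitive_root (w j).
Local Notation S := {mpoly C[d]}.
Local Notation Q := #|W q|.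
Implicit Types (F G : {poly S}) (k : 'I_Q).

(** The part linear in s of the Laplacian's eigenvalue on the k-th plane wave, dominant for large
    t. *)
Definition freq k : S := \sum_j w j ^+ (enum_val k : W q) j *: 'X_j.

(** The coefficient of s_j is a power of the primitive root [w j] with exponent below [q j], so it
    determines the exponent. *)
Lemma freq_inj : injective freq.
Proof.
move=> k k' eq_kk'; apply/enum_val_inj/ffunP => j; apply: val_inj => /=.
have coefE k1 : (freq k1)@_U_(j) = w j ^+ (enum_val k1 : W q) j.
  rewrite /freq raddf_sum (bigD1 j) //= mcoeffZ mcoeffXU eqxx mulr1 big1 ?addr0 //.
  by move=> i /negPf i_j; rewrite mcoeffZ mcoeffXU i_j mulr0.
have /eqP := congr1 (mcoeff U_(j)) eq_kk'; rewrite !coefE.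
by rewrite (eq_prim_root_expr (w_prim j)) !modn_small // => /eqP.
Qed.

Lemma meval_freq k s :
  (freq k).@[s] = \sum_j w j ^+ (enum_val k : W q) j * s j.
Proof.
rewrite /freq rmorph_sum; apply: eq_bigr => j _.
by rewrite /= mevalZ mevalXU.
Qed.

Definition zero_index : 'I_Q := enum_rank ([ffun j => Ordinal (q_gt0 j)] : W q).

(** Transitivity: rotations carry s_1 + ... + s_d to every frequency. *)
Lemma rotate_freq k :
  rotate_z (fun j => w j ^+ (enum_val k : W q) j) (freq zero_index) = freq k.
Proof.
rewrite /rotate_z /freq rmorph_sum; apply: eq_bigr => j _.
by rewrite enum_rankK ffunE expr0 scale1r /= mmapX mmap1U.
Qed.

(** Rotations fix the leading coefficient in t, hence map its roots to roots. *)
Lemma root_freq F k :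
  (lead_coef (scale_zl q F)).[- freq zero_index] = 0 ->
  (lead_coef (scale_zl q F)).[- freq k] = 0.
Proof.
pose a j := w j ^+ (enum_val k : W q) j.
have aq j : a j ^+ q j = 1.
  by rewrite /a -exprM mulnC exprM (prim_expr_order (w_prim j)) expr1n.
set A := lead_coef _ => root0.
have rotA : map_poly (rotate_z a) A = A.
  (* A fixed index avoids comparing sizes before and after the rotation. *)
  pose top (P : {poly {poly S}}) := P`_(size (scale_zl q F)).-1.
  by have := congr1 top (rotate_scale_zl F aq); rewrite /top coef_map.
by rewrite -(rotate_freq k) -/a -rmorphN -[in LHS]rotA /= horner_map root0 rmorph0.
Qed.

(** With each row multiplied by t, the matrix of [Pol_fourier] has degree at most 2 in t, and its
    t^2 part is diagonal with entries -(freq + x). The constant matrix [E] and the inverse terms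
    have lower order and drop out. *)
Lemma lead_scale_zl F G N :
  (forall z, torus z -> forall l,
    (map_poly (meval z) F).[l] * (map_poly (meval z) G).[l] =
    (\prod_j z j) ^+ N * Pol q V z l) ->
  lead_coef (scale_zl q F) * lead_coef (scale_zl q G) =
  ((\prod_j 'X_j ^+ q j) ^+ N * (-1) ^+ Q)%:P * \prod_k ('X + (freq k)%:P).
Proof.
move=> FG; have [E PolE] := Pol_fourier q_gt0 w_prim V.
(* Pol_fourier at [tau = s t], [l = t x], multiplied by [t] to clear 1/t. *)
pose H (s : 'I_d -> C) x : 'M[{poly C}]_Q := \matrix_(i, k)
  ((E i k)%:P * 'X - (((freq i).@[s] + x)%:P * 'X^2 +
     (\sum_j (w j ^+ (enum_val i : W q) j * s j)^-1)%:P) *+ (i == k)).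
have szH s x i k : (size (H s x i k) <= 3)%N.
  apply/leq_sizeP => m lt_m; rewrite mxE coefD coefN coefCM coefX coefMn coefD coefCM.
  by rewrite coefXn coefC; case: m lt_m => [|[|[|m]]] //= _; rewrite !mulr0 addr0 mul0rn subr0.
have coefH s x i k : (H s x i k)`_2 = (- ((freq i).@[s] + x)) *+ (i == k).
  rewrite mxE coefD coefN coefCM coefX mulr0 add0r coefMn coefD coefCM coefXn.
  by rewrite coefC mulr1 addr0 mulNrn.
(* The power of t contributed by the monomial factor. *)
pose M := ((\sum_j q j) * N)%N.
have evalE s x : torus s ->
  'X^Q * eval_sx s x (scale_zl q F * scale_zl q G) =
  (\prod_j s j ^+ q j) ^+ N *: ('X^M * \det (H s x)).
  move=> ts; apply: poly_eq_nonzero => t t0.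
  pose z j := (s j * t) ^+ q j.
  transitivity (t ^+ Q *
      ((map_poly (meval z) F).[t * x] * (map_poly (meval z) G).[t * x])).
    rewrite eval_sxM hornerM hornerXn hornerM.
    by congr (_ * (_ * _)); exact: horner_eval_scale_zl.
  have tst : torus (fun j => s j * t) by move=> j; rewrite mulf_neq0.
  rewrite FG; last by move=> j; rewrite expf_neq0.
  rewrite PolE // hornerZ hornerM hornerXn.
  have -> : \prod_j (s j * t) ^+ q j = \prod_j s j ^+ q j * t ^+ \sum_j q j.
    rewrite -prodrXr -big_split; apply: eq_bigr => j _ /=; exact: exprMn.
  rewrite exprMn -exprM -/M mulrCA -mulrA; congr (_ * (_ * _)).
  have -> : (\det (H s x)).[t] = \det (map_mx (horner_eval t) (H s x)).
    by rewrite det_map_mx.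
  rewrite -detZ; congr (\det _); apply/matrixP => i k; rewrite !mxE /horner_eval.
  rewrite hornerD hornerN hornerCM hornerX hornerMn hornerD hornerCM hornerXn hornerC.
  rewrite mulrBr mulrC; congr (_ - _); rewrite mulrnAr; congr (_ *+ _).
  rewrite meval_freq big_split /= !mulrDr mulrDl addrAC; congr (_ + _ + _).
  - rewrite big_distrr big_distrl; apply: eq_bigr => j _ /=.
    by rewrite mulrC -!mulrA.
  - by rewrite mulrA mulrC.
  rewrite big_distrr; apply: eq_bigr => j _ /=.
  by rewrite mulrA invfM mulrCA mulfV // mulr1.
have coefG s x i : torus s -> (eval_sx s x (scale_zl q F * scale_zl q G))`_(M + i) =
   (\prod_j s j ^+ q j) ^+ N * (\det (H s x))`_(i + Q).
  move=> ts; have := congr1 (fun p : {poly C} => p`_(M + i + Q)) (evalE s x ts).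
  rewrite coefXnM ltnNge leq_addl /= addnK coefZ coefXnM => ->.
  by rewrite -addnA ltnNge leq_addr /= addKn.
have topH s x : (size (\det (H s x)) <= (Q * 2).+1)%N /\
    (\det (H s x))`_(Q * 2) = (-1) ^+ Q * \prod_k ((freq k).@[s] + x).
  have [sz ->] := det_poly_top (szH s x); split=> //.
  have -> : map_mx (fun p : {poly C} => p`_2) (H s x) =
      diag_mx (\row_k - ((freq k).@[s] + x)).
    by apply/matrixP => i k; rewrite [LHS]mxE coefH !mxE.
  rewrite det_diag -[X in (-1) ^+ X]card_ord -prodr_const -big_split.
  by apply: eq_bigr => k _; rewrite mxE /= mulN1r.
have eval_coef s x p i : (eval_sx s x p)`_i = (map_poly (meval s) p`_i).[x].
  by rewrite coef_map.
set P := scale_zl q F * scale_zl q G.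
set R := (X in _ = X).
(* The top degree in t is [M + 2Q] on the right of [evalE], less the [Q] on its left. *)
have PR : P`_(M + Q) = R.
  apply: polympoly_eq => s ts x; rewrite -eval_coef coefG // addnn -muln2.
  rewrite (topH s x).2 rmorphM /= map_polyC /=.
  rewrite hornerM hornerC rmorph_prod horner_prod rmorphM -mulrA; congr (_ * (_ * _)).
  - rewrite rmorphXn rmorph_prod; congr (_ ^+ _); apply: eq_bigr => j _.
    by rewrite rmorphXn /= mevalXU.
  - by rewrite rmorphXn rmorphN1.
  apply: eq_bigr => k _; rewrite rmorphD /= map_polyX map_polyC.
  by rewrite hornerD hornerX hornerC addrC.
have R0 : R != 0.
  rewrite mulf_neq0 ?polyC_eq0 //; last first.
    by apply/prodf_neq0 => k _; rewrite -[freq k]opprK polyCN polyXsubC_eq0.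
  rewrite mulf_neq0 ?signr_eq0 // expf_neq0 //; apply/prodf_neq0 => j _.
  by rewrite expf_neq0 // -msupp_eq0 msuppX.
have P_hi i : (M + Q < i)%N -> P`_i = 0.
  move=> lt_i; apply: polympoly_eq => s ts x.
  have iE : (M + (i - M))%N = i.
    by apply: subnKC; exact: leq_trans (leq_addr _ _) (ltnW lt_i).
  rewrite -eval_coef -iE coefG //.
  have -> : (\det (H s x))`_(i - M + Q) = 0.
    rewrite nth_default //; apply: leq_trans (topH s x).1 _.
    by rewrite muln2 -addnn ltn_add2r ltn_subRL.
  by rewrite mulr0 rmorph0 horner0.
(* Since [R] is nonzero, the degree bound is attained. *)
have szP : size P = (M + Q).+1.
  apply/eqP; rewrite eqn_leq; apply/andP; split; first exact/leq_sizeP.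
  by rewrite ltnNge; apply: contraNN R0 => /leq_sizeP /(_ _ (leqnn _)) <-; rewrite PR.
by rewrite -lead_coefM -/P lead_coefE szP.
Qed.

(** One top part has all Q roots, so its degree in x is at least Q, and the factor has at least this
    degree in l. *)
Lemma size_factor F G N :
  (forall z, torus z -> forall l,
    (map_poly (meval z) F).[l] * (map_poly (meval z) G).[l] =
    (\prod_j z j) ^+ N * Pol q V z l) ->
  (Q < size F)%N \/ (Q < size G)%N.
Proof.
move=> FG.
have a0 : (\prod_j 'X_j ^+ q j) ^+ N * (-1) ^+ Q != 0 :> S.
  rewrite mulf_neq0 ?signr_eq0 // expf_neq0 //; apply/prodf_neq0 => j _.
  by rewrite expf_neq0 // -msupp_eq0 msuppX.
have := size_gt_of_roots freq_inj a0 (lead_scale_zl FG)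
  (fun r k => @root_freq F k r) (fun r k => @root_freq G k r).
rewrite card_ord => -[] /leq_trans sz; [left | right]; apply: sz;
exact: size_coef_scale_zl.
Qed.

(** [Pol] has degree Q in l with leading coefficient (-1)^Q, so a factor of degree at least Q leaves
    the other constant in l. The leading coefficients then multiply to a monomial up to sign. *)
Lemma right_factor_monomial F G N :
  (forall z, torus z -> forall l,
    (map_poly (meval z) F).[l] * (map_poly (meval z) G).[l] =
    (\prod_j z j) ^+ N * Pol q V z l) ->
  (Q < size F)%N -> exists c m, c != 0 /\ G = (c *: 'X_[m])%:P.
Proof.
move=> FG szF.
have prodE z : torus z -> map_poly (meval z) F * map_poly (meval z) G =
    ((\prod_j z j) ^+ N * (-1) ^+ Q) *: char_poly (Dmat q V z).
  move=> tz; apply: poly_eq_nonzero => l _.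
  by rewrite hornerM FG // /Pol horner_char_poly -scalerA [RHS]hornerZ.
have prod_neq0 (z : 'I_d -> C) : torus z -> (\prod_j z j) ^+ N * (-1) ^+ Q != 0.
  by move=> tz; rewrite mulf_neq0 ?signr_eq0 // expf_neq0 //; apply/prodf_neq0.
have G0 : G != 0.
  apply/negP => /eqP G0; pose z (j : 'I_d) : C := 1.
  have tz : torus z by move=> j; exact: oner_neq0.
  have /eqP := prodE z tz; rewrite G0 rmorph0 mulr0 eq_sym scaler_eq0.
  by rewrite (negPf (prod_neq0 z tz)) -size_poly_eq0 size_char_poly.
have F0 : F != 0 by rewrite -size_poly_gt0 (leq_ltn_trans _ szF).
(* Where neither leading coefficient vanishes, specialization preserves both degrees in l. *)
have [z tz] : exists2 z, torus z & (lead_coef F * lead_coef G).@[z] != 0.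
  by apply: mpoly_neq0_torus; rewrite mulf_neq0 ?lead_coef_eq0.
rewrite mevalM mulf_eq0 negb_or => /andP[Fz Gz].
have szFz : size (map_poly (meval z) F) = size F by rewrite size_map_poly_id0.
have szGz : size (map_poly (meval z) G) = size G by rewrite size_map_poly_id0.
have : size (map_poly (meval z) F * map_poly (meval z) G) = Q.+1.
  by rewrite prodE // size_scale ?prod_neq0 // size_char_poly.
rewrite size_mul -?size_poly_gt0 ?szFz ?szGz ?size_poly_gt0 //.
move=> szFG.
have [szF1 szG1] : size F = Q.+1 /\ size G = 1.
  have : (0 < size G)%N by rewrite size_poly_gt0.
  case: (size G) szFG => // b; rewrite addnS /= => szFb _.
  have : (Q.+1 + b <= Q.+1 + 0)%N by rewrite addn0 -[leqRHS]szFb leq_add2r.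
  by rewrite leq_add2l leqn0 => /eqP b0; split; rewrite -?szFb b0 ?addn0.
have /size_poly1P[b b0 GE] : size G == 1 by rewrite szG1.
have : F`_Q * b = (-1) ^+ Q *: 'X_[ [multinom N | j < d] ].
  apply: mpoly_eq_torus => s ts.
  have := congr1 (fun p : {poly C} => p`_Q) (prodE s ts).
  rewrite GE map_polyC coefMC coef_map mevalM => ->.
  rewrite coefZ mevalZ mevalX.
  have := char_poly_monic (Dmat q V s).
  rewrite monicE lead_coefE size_char_poly => /eqP->.
  rewrite mulr1 mulrC; congr (_ * _).
  by rewrite -prodrXl; apply: eq_bigr => j _; rewrite mnmE.
rewrite mulrC => /mpoly_dvd_monomial[|c [m [c0 bE]]]; first by rewrite signr_eq0.
by exists c, m; rewrite GE bE.
Qed.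

End Bloch.

(** Dividing out the clearing factor lowers each exponent by [N]. *)
Lemma factor_monomial (C : numClosedFieldType) (d : nat) (f : ('I_d -> C) -> C -> C)
    N c (m : 'X_{1..d}) : c != 0 ->
  (forall z, torus z -> forall l,
    (map_poly (meval z) (c *: 'X_[m])%:P).[l] = (\prod_j z j) ^+ N * f z l) ->
  monomial_fun f.
Proof.
move=> c0 fE; exists c, (fun j => (m j)%:Z - N%:Z); split=> // z tz l.
have N0 : (\prod_j z j) ^+ N != 0 by rewrite expf_neq0 //; apply/prodf_neq0.
apply: (mulfI N0); rewrite -fE // map_polyC hornerC /= mevalZ mevalX mulrCA.
congr (_ * _); rewrite /zpow -prodrXl -big_split; apply: eq_bigr => j _ /=.
by rewrite !exprnP -expfzDr // addrC subrK.
Qed.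

Theorem mainTheorem6 (R : realType) (d : nat) (q : 'I_d -> nat)
  (V : lat d -> R[i]) :
  (2 <= d)%N ->
  (forall j, (0 < q j)%N) ->
  \big[gcdn/0%N]_(j < d) q j = 1%N ->
  periodic q V ->
  ~ (exists f1 f2 : ('I_d -> R[i]) -> R[i] -> R[i],
        [/\ laurent_poly_fun f1, laurent_poly_fun f2,
            ~ monomial_fun f1, ~ monomial_fun f2 &
            forall z, torus z -> forall l, Pol q V z l = f1 z l * f2 z l]).
Proof.
move=> _ q_gt0 _ _ [f1 [f2 [/laurent_clear[N1 [F1 F1E]] /laurent_clear[N2 [F2 F2E]]]]].
move=> f1_mon f2_mon PolE.
have [w w_prim] : exists w : 'I_d -> R[i], forall j, (q j).-primitive_root (w j).
  exists (fun j => xchoose (prim_root_exists R[i] (q_gt0 j))) => j.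
  exact: xchooseP.
have F12 z : torus z -> forall l,
    (map_poly (meval z) F1).[l] * (map_poly (meval z) F2).[l] =
    (\prod_j z j) ^+ (N1 + N2) * Pol q V z l.
  by move=> tz l; rewrite F1E // F2E // PolE // mulrACA exprD.
have F21 z : torus z -> forall l,
    (map_poly (meval z) F2).[l] * (map_poly (meval z) F1).[l] =
    (\prod_j z j) ^+ (N1 + N2) * Pol q V z l.
  by move=> tz l; rewrite mulrC F12.
(* Whichever factor has degree at least Q in l, the other is a monomial. *)
case: (size_factor q_gt0 w_prim F12) => [/(right_factor_monomial F12)|/(right_factor_monomial F21)].
  by move=> [c [m [c0 E2]]]; apply: f2_mon; rewrite E2 in F2E; exact: factor_monomial F2E.
by move=> [c [m [c0 E1]]]; apply: f1_mon; rewrite E1 in F1E; exact: factor_monomial F1E.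
Qed.
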